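(* Let a finite group $G$ be the product $G=G_1G_2\cdots G_n$ of soluble subgroups $G_1,\dots,G_n$ which are pairwise mutually permutable (i.e. $G_iG_j$ is a mutually permutable product of $G_i$ and $G_j$ for all $i\neq j$). For $i\neq j$ let $\Gamma(G_i,G_j)$ be the graph with vertex set $\pi(G_i)\cup\pi(G_j)$ and edge set $\{(p,q)\mid p\in\pi(G_i),\ q\in\pi(G_j)\cap\pi(p-1)\ \text{ or }\ p\in\pi(G_j),\ q\in\pi(G_i)\cap\pi(p-1)\}$, and let $L$ be the graph with vertex set $\pi(G)$ and edge set $\{(p,p)\mid p\in\pi(G)\}$. Then $$\Gamma_H(G)\subseteq\bigcup_{1\le i\le n}\Gamma_H(G_i)\cup\bigcup_{1\le i,j\le n,\ i\ne j}\Gamma(G_i,G_j)\cup L$$ and $$\Gamma_{Nc}(G)\subseteq\bigcup_{1\le i\le n}\Gamma_{Nc}(G_i)\cup\bigcup_{1\le i,j\le n,\ i\ne j}\Gamma(G_i,G_j).$$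
   Context: All groups are finite; $\pi(G)$ denotes the set of prime divisors of $|G|$, and $\pi(n)$ the set of prime divisors of an integer $n$. Graphs are directed: a graph consists of a vertex set and an edge set of ordered pairs of vertices; union takes unions of vertex and edge sets, and $\subseteq$ means inclusion of vertex sets and of edge sets. $O_{p',p}(G)$ is the largest normal $p$-nilpotent subgroup of $G$. The Hawkes graph $\Gamma_H(G)$ has vertex set $\pi(G)$ and an edge $(p,q)$ whenever $q\in\pi(G/O_{p',p}(G))$. A Schmidt group is a non-nilpotent group all of whose proper subgroups are nilpotent; a Schmidt $(p,q)$-group is a Schmidt group $S$ with $\pi(S)=\{p,q\}$ and a normal Sylow $p$-subgroup. The $N$-critical graph $\Gamma_{Nc}(G)$ has vertex set $\pi(G)$ and an edge $(p,q)$ whenever $G$ contains a Schmidt $(p,q)$-subgroup. A group $X=HK$ is a mutually permutable product of subgroups $H,K$ if $H$ permutes with every subgroup of $K$ and $K$ permutes with every subgroup of $H$. *)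

(* Defs.v *)
From mathcomp Require Import all_boot all_fingroup all_solvable.
Set Implicit Arguments. Unset Strict Implicit. Unset Printing Implicit Defensive.

Local Open Scope group_scope.

Record graph := Graph { vert : nat -> Prop; edge : nat -> nat -> Prop }.

Definition subgraph (A B : graph) : Prop :=
  (forall p, vert A p -> vert B p) /\ (forall p q, edge A p q -> edge B p q).

Definition gunion (A B : graph) : graph :=
  Graph (fun p => vert A p \/ vert B p) (fun p q => edge A p q \/ edge B p q).

Definition gbigunion (I : Type) (P : I -> Prop) (F : I -> graph) : graph :=
  Graph (fun p => exists2 i, P i & vert (F i) p)
        (fun p q => exists2 i, P i & edge (F i) p q).

Section Defs.
Variable gT : finGroupType.

Definition hawkes_graph (G : {group gT}) : graph :=
  Graph (fun p => p \in \pi(G))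
        (fun p q => p \in \pi(G) /\ q \in \pi(G / 'O_{p^', p}(G))).

Definition schmidt (S : {group gT}) : Prop :=
  ~~ nilpotent S /\ (forall H : {group gT}, H \proper S -> nilpotent H).

Definition schmidt_pq (p q : nat) (S : {group gT}) : Prop :=
  schmidt S /\ (forall r, (r \in \pi(S)) = (r \in [:: p; q])) /\
  (exists P : {group gT}, p.-Sylow(S) P /\ P <| S).

Definition ncritical_graph (G : {group gT}) : graph :=
  Graph (fun p => p \in \pi(G))
        (fun p q => exists S : {group gT}, S \subset G /\ schmidt_pq p q S).

Definition gamma_graph (A B : {group gT}) : graph :=
  Graph (fun p => p \in \pi(A) \/ p \in \pi(B))
        (fun p q => (p \in \pi(A) /\ q \in \pi(B) /\ q \in \pi(p.-1)) \/
                    (p \in \pi(B) /\ q \in \pi(A) /\ q \in \pi(p.-1))).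

Definition loop_graph (G : {group gT}) : graph :=
  Graph (fun p => p \in \pi(G)) (fun p q => p \in \pi(G) /\ q = p).

Definition mutually_permutable (H K : {group gT}) : Prop :=
  (forall X : {group gT}, X \subset K -> H * X = X * H) /\
  (forall X : {group gT}, X \subset H -> K * X = X * K).

End Defs.

(* Main.v *)
From Stdlib Require Import Classical_Prop.
Require Import Defs.
From mathcomp Require Import all_boot all_fingroup all_solvable.

Set Implicit Arguments. Unset Strict Implicit. Unset Printing Implicit Defensive.

Local Open Scope group_scope.

(* For a normal subgroup W of G the product W* of the subgroups G_i :&: W is
   again normal, and it is a pairwise mutually permutable product. This reduces
   solubility of G to the case where G is simple; there, for a minimal set of
   factors, each factor produces a subgroup of prime index containing all the
   other factors. A simple group with a subgroup of prime index r embeds in Sym(r),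
   so r is its largest prime divisor and r^2 does not divide its order; with two
   factors, no factor could then have order divisible by r.

   For G soluble, a minimal normal W with W* <> 1 is a t-group equal to W*, and
   if O_{p'}(G) = 1 then t = p. A q-subgroup Q of G_j centralises W: it centralises
   G_j :&: W since G_j has no edge (p, q), and it normalises X (G_j :&: W) for all
   X in G_i :&: W, hence acts trivially along a chain of steps of order p because
   q does not divide p - 1, unless (p, q) is an edge of Gamma(G_i, G_j). So
   induction applies to G / W, for both graphs. *)

(** * Joins of pairwise permuting subgroups *)

Section Joins.

Variables (gT : finGroupType) (I : finType) (Gs : I -> {group gT}).
Hypothesis commGs : forall i j, commute (Gs i : {set gT}) (Gs j).
Implicit Types (P : pred I) (X : {set gT}).

Lemma commute_joinG (A B : {group gT}) X :
    commute (A : {set gT}) B -> commute X A -> commute X B ->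
  commute X (A <*> B).
Proof. by move=> cAB cXA cXB; rewrite comm_joingE //; apply: commuteM. Qed.

Lemma commute_bigjoin P X :
  (forall i, P i -> commute X (Gs i)) -> commute X (\prod_(i | P i) Gs i)%G.
Proof.
move=> cX.
(* Carrying along that each factor permutes with the partial join makes every new join a set
   product. *)
suff []: commute X (\prod_(i | P i) Gs i)%G /\
  forall i, commute (Gs i : {set gT}) (\prod_(i | P i) Gs i)%G by [].
elim/big_rec: _ => [|i H Pi [cXH cH]].
  by split=> [|i]; apply: commute1.
by split=> [|k]; apply: commute_joinG => //; apply: cX.
Qed.

Lemma bigjoin_sub P (H : {group gT}) :
  ((\prod_(i | P i) Gs i)%G \subset H) = [forall (i | P i), Gs i \subset H].
Proof.
rewrite bigprodGE gen_subG; apply/bigcupsP/forall_inP; exact.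
Qed.

Lemma sub_bigjoin P i : P i -> Gs i \subset (\prod_(i | P i) Gs i)%G.
Proof. by move=> Pi; rewrite bigprodGE sub_gen // (bigcup_max i). Qed.

(** Since the factors permute, each partial join is a set product, so its order divides the product
    of the orders of its factors and no new primes appear. *)
Lemma bigjoin_pgroup (pi : nat_pred) P :
  (forall i, P i -> pi.-group (Gs i)) -> pi.-group (\prod_(i | P i) Gs i)%G.
Proof.
move=> piG.
suff []: pi.-group (\prod_(i | P i) Gs i)%G /\
  forall i, commute (Gs i : {set gT}) (\prod_(i | P i) Gs i)%G by [].
elim/big_rec: _ => [|i H Pi [piH cH]].
  by split=> [|i]; [apply: pgroup1 | apply: commute1].
split=> [|k]; last exact: commute_joinG.
by rewrite /= comm_joingE // pgroupM piG.
Qed.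

End Joins.

Lemma prodsg_bigjoin (gT : finGroupType) (n : nat) (Gs : 'I_n -> {group gT}) :
    (forall i j, commute (Gs i : {set gT}) (Gs j)) ->
  \prod_(i < n) (Gs i : {set gT}) = (\prod_(i < n) Gs i)%G.
Proof.
move=> cG.
suff []: \prod_(i < n) (Gs i : {set gT}) = (\prod_(i < n) Gs i)%G /\
  forall i, commute (Gs i : {set gT}) (\prod_(i < n) Gs i)%G by [].
elim/big_rec2: _ => [|i H A _ [-> cH]].
  by split=> // i; apply: commute1.
split=> [|k]; first by rewrite /= comm_joingE.
by apply: commute_joinG.
Qed.

(** * Mutually permutable families: intersections, quotients, normality *)

Section Pmp.

Definition pmp (gT : finGroupType) (I : finType) (Gs : I -> {group gT}) :=
  forall i j, i != j -> mutually_permutable (Gs i) (Gs j).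

Variables (gT : finGroupType) (I : finType) (Gs : I -> {group gT}).
Hypothesis pmpG : pmp Gs.

Lemma pmp_commute i j : commute (Gs i : {set gT}) (Gs j).
Proof. by have [->|/pmpG[perm_ij _]] := eqVneq i j; last exact: perm_ij. Qed.

Lemma pmp_perm i j (X : {group gT}) :
  i != j -> X \subset Gs j -> commute (Gs i : {set gT}) X.
Proof. by move=> ij sX; have [perm_ij _] := pmpG ij; apply: perm_ij. Qed.

(** For [X] inside [Gs j :&: W], the modular law turns both [(Gs i :&: W) * X] and
    [X * (Gs i :&: W)] into [(Gs i * X) :&: W]. *)
Lemma pmp_setI (W : {group gT}) : pmp (fun i => Gs i :&: W)%G.
Proof.
suff half i j (X : {group gT}) : i != j -> X \subset Gs j :&: W ->
    commute (Gs i :&: W) X.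
  by move=> i j ij; split=> X sX;
    [apply: (half i j) | apply: (half j i); rewrite // eq_sym].
move=> ij; rewrite subsetI => /andP[sXG sXW].
by rewrite /commute group_modl // -(pmp_perm ij sXG) [Gs i :&: W]setIC group_modr // setIC.
Qed.

Lemma pmp_quotient (N : {group gT}) :
  (forall i, Gs i \subset 'N(N)) -> pmp (fun i => Gs i / N)%G.
Proof.
move=> nN.
suff half i j (X : {group coset_of N}) : i != j -> X \subset Gs j / N ->
    commute (Gs i / N) X.
  by move=> i j ij; split=> X sX;
    [apply: (half i j) | apply: (half j i); rewrite // eq_sym].
move=> ij sX; pose Y := [group of Gs j :&: coset N @*^-1 X].
have sYG : Y \subset Gs j by apply: subsetIl.
have <-: Y / N = X by rewrite /= /quotient morphim_setIpre; apply/setIidPr.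
by rewrite /commute -!quotientMl ?(pmp_perm ij) // (subset_trans sYG).
Qed.

Lemma bigjoin_quotient (N : {group gT}) P :
    (forall i, Gs i \subset 'N(N)) ->
  (\prod_(i | P i) (Gs i / N))%G = ((\prod_(i | P i) Gs i) / N)%G.
Proof.
move=> nN.
suff []: (\prod_(i | P i) Gs i)%G \subset 'N(N) /\
  (\prod_(i | P i) (Gs i / N))%G = ((\prod_(i | P i) Gs i) / N)%G by [].
elim/big_rec2: _ => [|i K H _ [nH ->]].
  by rewrite sub1G; split=> //; apply/val_inj; rewrite /= quotient1.
split; first by rewrite join_subG nN.
by apply/val_inj; rewrite /= quotientY.
Qed.

(* [G_i] normalises [(G_i X) :&: W = X (G_i :&: W)] for every [X \subset G_j :&: W]. *)
Lemma norm_mul_setI (W X : {group gT}) i j :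
    Gs i \subset 'N(W) -> i != j -> X \subset Gs j :&: W ->
  Gs i \subset 'N(X <*> (Gs i :&: W)).
Proof.
move=> nW ij; rewrite subsetI => /andP[sXG sXW].
have cX := pmp_perm ij sXG.
rewrite comm_joingE; last first.
  by rewrite /commute /= group_modl // -cX [Gs i :&: W]setIC group_modr // setIC.
rewrite /= group_modl // -cX -comm_joingE //.
by rewrite normsI // (subset_trans _ (normG _)) ?joing_subl.
Qed.

(** A single [Gs j :&: W] need not be normal, but its conjugates under [Gs i] stay inside
    [(Gs j :&: W) <*> (Gs i :&: W)], which [Gs i] normalises and which lies in the join. *)
Lemma bigjoin_setI_normal (G W : {group gT}) :
    G = (\prod_i Gs i)%G -> W <| G -> (\prod_i (Gs i :&: W))%G <| G.
Proof.
move=> defG nsWG; have sGi i : Gs i \subset G by rewrite defG sub_bigjoin.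
have nW i : Gs i \subset 'N(W) by rewrite (subset_trans (sGi i)) ?normal_norm.
rewrite /normal bigjoin_sub; apply/andP; split.
  by apply/forall_inP=> i _ /=; rewrite subIset ?sGi.
rewrite {1}defG bigjoin_sub; apply/forall_inP=> i _.
(* The conjugation is moved to the right-hand side so that the inclusion can be tested factor by
   factor. *)
apply/subsetP=> g Gig; rewrite inE sub_conjg (bigjoin_sub _ _ (_ :^ _)%G) /=.
apply/forall_inP=> j _; rewrite -sub_conjg /=.
have [eq_ij | ij] := eqVneq i j.
  rewrite -eq_ij (subset_trans _ (sub_bigjoin _ (i := i) _)) //=.
  by rewrite conjIg conjGid // (normsP (nW i)).
have /normsP nXg := norm_mul_setI (nW i) ij (subxx (Gs j :&: W)).
apply: subset_trans (_ : (Gs j :&: W) <*> (Gs i :&: W) \subset _).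
  by rewrite -(nXg g Gig) conjSg joing_subl.
by rewrite join_subG !(sub_bigjoin (fun i => (Gs i :&: W)%G)).
Qed.

End Pmp.

(** * Permutable subgroups and prime index *)

(* Ore: a maximal proper permutable subgroup [E] is normal, since otherwise the
   permutable subgroup [E E^b] would be the whole group, which forces [b \in E]. *)
Lemma permutable_sub_normal (gT : finGroupType) (B D : {group gT}) :
    D \proper B ->
    (forall X : {group gT}, X \subset B -> commute (D : {set gT}) X) ->
  exists2 E : {group gT}, D \subset E & (E <| B) && (E \proper B).
Proof.
move=> ltDB permD.
pose perm (E : {group gT}) :=
  [forall X : {group gT}, (X \subset B) ==> (E * X == X * E)].
have permP (E : {group gT}) : reflect
    (forall X : {group gT}, X \subset B -> commute (E : {set gT}) X) (perm E).
  apply: (iffP forallP) => pE X; first by move=> sXB; apply/eqP/(implyP (pE X)).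
  by apply/implyP=> sXB; apply/eqP/pE.
have: (D \proper B) && perm D by rewrite ltDB; apply/permP.
case/(maxgroup_exists (gP := fun E => (E \proper B) && perm E))=> E maxE sDE.
exists E => //; have [/andP[ltEB /permP pE] maxE'] := maxgroupP maxE.
rewrite ltEB andbT /normal (proper_sub ltEB).
apply/subsetP=> b Bb; rewrite inE.
have pEb (X : {group gT}) : X \subset B -> commute (E :^ b) X.
  move=> sXB; rewrite /commute -[X : {set gT}](conjsgKV b) -!conjsMg.
  by rewrite -[X :^ _]/(gval (X :^ _)%G) pE //= sub_conjgV conjGid.
have sEbB : E :^ b \subset B by rewrite sub_conjg conjGid ?groupV // proper_sub.
have cEEb : commute (E : {set gT}) (E :^ b)%G by apply: pE.
have pF : perm (E <*> E :^ b)%G.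
  apply/permP=> X sXB; rewrite /= comm_joingE //=.
  by apply/commute_sym/commuteM; apply/commute_sym; [apply: pE | apply: pEb].
have [ltFB | ] := boolP ((E <*> E :^ b)%G \proper B).
  have eqF : E <*> E :^ b = E by apply: maxE'; rewrite ?ltFB ?joing_subl.
  by apply: subset_trans (joing_subr E (E :^ b)) _; rewrite eqF.
rewrite properE join_subG (proper_sub ltEB) sEbB negbK => sBF.
have /imset2P[e _ Ee /imsetP[f Ef ->] def_b] : b \in E * E :^ b.
  by rewrite -(comm_joingE cEEb) (subsetP sBF).
suff Eb : b \in E by rewrite conjGid.
have def_e : e^-1 = b^-1 * f.
  by apply: (mulgI e); apply: (mulIg b); rewrite mulgV mul1g {1}def_b conjgE !mulgA.
by rewrite -groupV -(mulgK f b^-1) -def_e groupM ?groupV.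
Qed.

(** Ore's argument applied to [H :&: B] in [B] gives a proper normal subgroup of [B] above it.
    Enlarged to a maximal one, [C], it has prime index because [B] is soluble. As
    [H :&: C = H :&: B], comparing orders shows that [M = H <*> C] has index [#|B : C|]. *)
Lemma permutable_prime_index (gT : finGroupType) (H B : {group gT}) :
    solvable B -> ~~ (B \subset H) ->
    (forall X : {group gT}, X \subset B -> commute (H : {set gT}) X) ->
  exists M : {group gT},
    [/\ H \subset M, M \subset H <*> B & prime #|H <*> B : M|].
Proof.
move=> solB nsBH permH; pose D := (H :&: B)%G.
have permD (X : {group gT}) : X \subset B -> commute (D : {set gT}) X.
  by move=> sXB; rewrite /commute /= group_modl // -permH // [H :&: B]setIC group_modr // setIC.
have ltDB : D \proper B by rewrite properE subsetIr subsetI subxx andbT.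
have [E sDE /andP[nsEB ltEB]] := permutable_sub_normal ltDB permD.
have: (E \proper B) && (B \subset 'N(E)) by rewrite ltEB normal_norm.
case/(maxgroup_exists (gP := fun K : {group gT} => (K \proper B) && (B \subset 'N(K)))).
move=> C maxC sEC; have ltCB := maxnormal_proper maxC.
have prC := index_maxnormal_sol_prime solB maxC; have sCB := proper_sub ltCB.
have eqD : H :&: C = H :&: B.
  by apply/eqP; rewrite eqEsubset setIS //= subsetI subsetIl (subset_trans sDE).
exists (H <*> C)%G; rewrite joing_subl join_subG joing_subl.
rewrite (subset_trans sCB (joing_subr _ _)); split=> //=.
suff -> : #|H <*> B : H <*> C| = #|B : C| by [].
have permJ (K : {group gT}) : K \subset B -> H <*> K = H * K.
  by move=> sKB; rewrite comm_joingE //; apply: permH.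
have sJ : H <*> C \subset H <*> B by rewrite genS ?setUS.
rewrite -(divgS sJ) -(divgS sCB) /= !permJ //.
have cards (K : {group gT}) : K \subset B -> H :&: K = D ->
    (#|(H * K)%g| = #|H| * #|K| %/ #|D|)%N.
  by move=> sKB <-; rewrite mul_cardG mulnK ?cardG_gt0.
rewrite (cards B) // (cards C) //.
have sDC : D \subset C by rewrite /= -eqD subsetIr.
rewrite -(Lagrange sCB) -(Lagrange sDC).
move: (cardG_gt0 H) (cardG_gt0 D) (indexg_gt0 C D).
move: #|H| #|D| #|C : D| #|B : C| => h d c i h0 d0 c0.
rewrite -!mulnA !(mulnCA h d) !mulKn // !mulnA !mulKn // muln_gt0; exact/andP.
Qed.

(** * Solubility of the product *)

(** The action on the cosets of [M] has the core as kernel, so [G] embeds in the symmetric group on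
    them. *)
Lemma card_dvdn_index_fact (gT : finGroupType) (G M : {group gT}) :
  gcore M G :=: 1 -> #|G| %| #|G : M|`!.
Proof.
move=> coreM; pose nRA : actby_cond G (rcosets M G) 'Rs := actsRs_rcosets M G.
have injf : 'injm (actperm <[nRA]>).
  by rewrite ker_actperm astab_actby setIT astabRs_rcosets coreM setIg1.
rewrite -(card_injm injf (subxx G)) -perm.card_Sym.
apply: (@cardSg _ (Group (Sym_group_set _)) [group of _ @* _]).
apply/subsetP=> _ /morphimP[g _ Gg ->]; rewrite inE; apply/subsetP=> X.
by apply: contraR => nSX; rewrite actpermE /= /actby (negPf nSX).
Qed.

Lemma simple_prime_index (gT : finGroupType) (G M : {group gT}) :
    simple G -> M \subset G -> prime #|G : M| ->
  (forall t, t \in \pi(G) -> t <= #|G : M|) /\ #|G : M|^'.-group M.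
Proof.
move=> simG sMG; set r := #|G : M| => pr_r.
(* The core of [M] is 1 or [G], and the latter would make the index 1. *)
have [_ /(_ (gcore M G)%G) []] := simpleP _ simG; first exact: gcore_normal.
  move=> /= coreM; have dvdG := card_dvdn_index_fact coreM.
  split.
    move=> t; rewrite mem_primes => /and3P[pr_t _ dvdt].
    have := dvdn_trans dvdt dvdG.
    rewrite fact_prod big_nat; elim/big_ind: _ => [|a b IHa IHb|i /andP[i0 ir]].
    - by rewrite dvdn1 => /eqP t1; rewrite t1 in pr_t.
    - by rewrite Euclid_dvdM // => /orP[].
    by move/dvdn_leq=> /(_ i0) /leq_trans; apply.
  rewrite /pgroup p'natE //; apply/negP=> rM.
  have : r ^ 2 %| r`!.
    by rewrite (dvdn_trans _ dvdG) // -(Lagrange sMG) expnS expn1 dvdn_mul.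
  (* Legendre's formula: [r %/ r ^ k] is 1 for [k = 1] and 0 for larger [k], so [r] divides its
     factorial exactly once. *)
  rewrite pfactor_dvdn ?fact_gt0 // logn_fact //.
  rewrite big_nat_recl ?prime_gt0 //= expn1 divnn prime_gt0 // big_nat.
  rewrite big1 // => i /andP[i0 _].
  by apply: divn_small; rewrite -{1}(expn1 r) (ltn_exp2l _ _ (prime_gt1 pr_r)).
move=> /= eqG; have sGM : G \subset M by rewrite (subset_trans _ (gcore_sub M G)) ?eqG.
by rewrite /r (eqP (_ : #|G : M| == 1%N)) ?indexg_eq1 in pr_r.
Qed.

Lemma pmp_simple_solvable (gT : finGroupType) (I : finType)
    (Gs : I -> {group gT}) (G : {group gT}) :
    simple G -> G = (\prod_i Gs i)%G -> pmp Gs -> (forall i, solvable (Gs i)) ->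
  solvable G.
Proof.
move=> simG defG pmpG solG; have comm := pmp_commute pmpG.
pose J (A : {set I}) := (\prod_(i in A) Gs i)%G.
(* For a minimal generating set of factors, the join of all but one does not contain the remaining
   one, so [permutable_prime_index] applies. *)
have [|A /minsetP[/eqP JA minA]] := @ex_minset _ (fun A => J A == G).
  by exists setT; rewrite defG /J; apply/eqP/eq_bigl=> i; rewrite inE.
have sGG i : Gs i \subset G by rewrite defG sub_bigjoin.
have [A1 | /card_gt1P[k [l [Ak Al kl]]]] := leqP #|A| 1.
  have [A0 | [k defA]] : A = set0 \/ exists k, A = [set k].
    have [A_0|A_1] : #|A| = 0%N \/ #|A| = 1%N by case: #|A| A1 => [|[]]; auto.
      by left; apply: cards0_eq.
    by right; apply/cards1P/eqP.
    by rewrite -JA /J A0 big_set0 solvable1.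
  by rewrite -JA /J defA big_set1.
have idx k' : k' \in A -> exists M : {group gT},
    [/\ M \subset G, prime #|G : M| & forall i, i \in A -> i != k' -> Gs i \subset M].
  move=> Ak'; pose H := J (A :\ k').
  have defGH : G = (H <*> Gs k')%G.
    rewrite -JA /J (big_setD1 k') //=; apply/val_inj; exact: joingC.
  have permH (X : {group gT}) : X \subset Gs k' -> commute (H : {set gT}) X.
    move=> sX; apply/commute_sym/commute_bigjoin => // i; rewrite !inE => /andP[ik _].
    by apply: commute_sym; apply: (pmp_perm pmpG) ik sX.
  have nsG : ~~ (Gs k' \subset H).
    apply/negP=> sGH; have /minA : J (A :\ k') == G.
      rewrite defGH; apply/eqP/val_inj => /=; exact/esym/joing_idPl.
    rewrite subD1set => /(_ isT) eqA; by rewrite -eqA !inE eqxx in Ak'.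
  have [M [sHM sMG pr_i]] := permutable_prime_index (solG k') nsG permH.
  exists M; rewrite defGH; split=> // i Ai ik.
  by rewrite (subset_trans _ sHM) // (sub_bigjoin Gs) ?inE ?ik.
have [M [sMG prM sM]] := idx k Ak; have [N [sNG prN sN]] := idx l Al.
have [maxM M'] := simple_prime_index simG sMG prM.
have [maxN N'] := simple_prime_index simG sNG prN.
have pi_ind (K : {group gT}) : prime #|G : K| -> #|G : K| \in \pi(G).
  by move=> prK; rewrite mem_primes prK cardG_gt0 dvdn_indexg.
(* Each index is the largest prime divisor of [#|G|]. *)
have eqr : #|G : M| = #|G : N|.
  by apply/eqP; rewrite eqn_leq maxM ?maxN ?pi_ind.
(* Factors in [A] other than [k] lie in [M], and factor [k] lies in [N]. Both orders are prime to
   the index, so [#|G|] would be too, although the index divides it. *)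
have: #|G : M|^'.-group (J A).
  apply: bigjoin_pgroup => // i Ai.
  have [-> | ik] := eqVneq i k; last exact: pgroupS (sM i Ai ik) M'.
  by rewrite eqr (pgroupS (sN k Ak kl)).
by rewrite JA /pgroup p'natE // dvdn_indexg.
Qed.

Lemma bigjoin_eq1 (gT : finGroupType) (I : finType) (Hs : I -> {group gT}) i :
  (\prod_i Hs i)%G :=: 1 -> Hs i :=: 1.
Proof. by move=> J1; apply/trivgP; rewrite -J1 sub_bigjoin. Qed.

(** Induction on the order, with [W] a maximal normal subgroup. If [V] is nontrivial, both [V] and
    [G / V] are smaller. Otherwise either [W] is trivial and [G] is simple, or [G / W] is simple and
    soluble, so of prime order; each factor then embeds in [G / W], and [G] is a group of prime
    power order. *)
Lemma pmp_solvable (gT : finGroupType) (I : finType) (Gs : I -> {group gT}) :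
    pmp Gs -> (forall i, solvable (Gs i)) ->
  solvable (\prod_i Gs i)%G.
Proof.
have [m] := ubnP #|(\prod_i Gs i)%G|.
elim: m => // m IHm in gT Gs *; rewrite ltnS => leGm pmpG solG.
set G := (\prod_i Gs i)%G in leGm *.
have [-> | ntG] := eqVneq (G : {set gT}) 1; first exact: solvable1.
have [W maxW] := ex_maxnormal_ntrivg ntG.
have nsWG := maxnormal_normal maxW; have sWG := maxnormal_sub maxW.
have sGG i : Gs i \subset G by apply: sub_bigjoin.
have solQ (N : {group gT}) : N <| G -> N :!=: 1 -> solvable (G / N).
  move=> nsNG ntN; have nN i : Gs i \subset 'N(N).
    by rewrite (subset_trans (sGG i)) ?normal_norm.
  have := @IHm _ (fun i => Gs i / N)%G; rewrite bigjoin_quotient //; apply.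
  - by apply: leq_trans leGm; rewrite ltn_quotient ?normal_sub.
  - exact: pmp_quotient.
  by move=> i; apply: quotient_sol.
pose V := (\prod_i (Gs i :&: W))%G.
have nsVG : V <| G by apply: bigjoin_setI_normal.
have [V1 | ntV] := eqVneq (V : {set gT}) 1; last first.
  rewrite (series_sol nsVG) solQ // andbT IHm //; last first.
  - by move=> i; apply: solvableS (solG i); apply: subsetIl.
  - exact: pmp_setI.
  apply: leq_trans leGm; apply: proper_card.
  apply: sub_proper_trans (maxnormal_proper maxW).
  by rewrite bigjoin_sub; apply/forall_inP=> i _; apply: subsetIr.
have [W1 | ntW] := eqVneq (W : {set gT}) 1.
  apply: (@pmp_simple_solvable _ _ Gs) => //.
  by rewrite simple_maxnormal -W1.
have simGW : simple (G / W) by rewrite quotient_simple.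
have pr_r := simple_sol_prime (solQ W nsWG ntW) simGW.
suff: #|G / W|.-group G by apply: pgroup_sol.
apply: bigjoin_pgroup => [|i _]; first exact: pmp_commute.
have nWi : Gs i \subset 'N(W) by rewrite (subset_trans (sGG i)) ?normal_norm.
have tiWi : W :&: Gs i = 1 by rewrite setIC; apply: (@bigjoin_eq1 _ _ (fun i => Gs i :&: W)%G).
rewrite /pgroup (card_isog (quotient_isog nWi tiWi)).
apply: pgroupS (quotientS W (sGG i)) _.
exact: pnat_id.
Qed.

(** Take [W] minimal among the normal subgroups with [J W] nontrivial; [J] is idempotent, so
    [J W = W]. For [M] maximal among the proper [G]-invariant subgroups of [W], [W / M] is a
    t-group, and [J M] is trivial by minimality. So each [Gs i :&: W] embeds in [W / M], and their
    join is a t-group. *)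
Lemma pmp_normal_primary (gT : finGroupType) (I : finType) (Gs : I -> {group gT})
    (G : {group gT}) :
    G = (\prod_i Gs i)%G -> pmp Gs -> solvable G -> G :!=: 1 ->
  exists (W : {group gT}) (t : nat),
    [/\ W <| G, W :!=: 1, prime t, t.-group W & W = (\prod_i (Gs i :&: W))%G].
Proof.
move=> defG pmpG solG ntG; have sGG i : Gs i \subset G by rewrite defG sub_bigjoin.
pose J (W : {group gT}) := (\prod_i (Gs i :&: W))%G.
have JG : J G = G.
  by rewrite [RHS]defG; apply: eq_bigr => i _; apply/val_inj/setIidPl.
have [|W /mingroupP[/andP[nsWG ntJW] minW]] :=
    @ex_mingroup _ (fun W => (W <| G) && (J W :!=: 1)).
  by exists G; rewrite normal_refl JG.
have sJW : J W \subset W by rewrite bigjoin_sub; apply/forall_inP=> i _; apply: subsetIr.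
have JJ : J (J W) = J W.
  apply: eq_bigr => i _; apply/val_inj/eqP; rewrite /= eqEsubset setIS //=.
  by rewrite subsetI subsetIl (sub_bigjoin (fun i => (Gs i :&: W)%G)).
have JW : J W = W.
  by apply/val_inj/minW; rewrite // JJ ntJW andbT; apply: bigjoin_setI_normal.
have ntW : W :!=: 1 by rewrite -JW.
have [|M maxM _] := @maxgroup_exists _
    (fun M : {group gT} => (M \proper W) && (G \subset 'N(M))) 1%G.
  by rewrite /= proper1G ntW norms1.
have [/andP[ltMW nMG] _] := maxgroupP maxM.
have sMW := proper_sub ltMW.
have nsMG : M <| G by rewrite /normal (subset_trans sMW) ?(normal_sub nsWG).
have JM : J M :=: 1.
  apply/eqP; apply: contraTT ltMW => ntJM.
  have eqMW : M :=: W by apply: minW => //; apply/andP.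
  by rewrite eqMW properxx.
have minWM : minnormal (W / M) (G / M).
  apply: maxnormal_minnormal maxM; last exact: normal_norm nsWG.
  exact: subset_trans (normal_sub nsWG) nMG.
have [_ _ /is_abelemP[t pr_t /abelem_pgroup tWM]] :=
  minnormal_solvable minWM (quotientS M (normal_sub nsWG)) (quotient_sol M solG).
exists W, t; split=> //; rewrite -JW.
apply: bigjoin_pgroup => [|i _]; first exact: pmp_commute (pmp_setI pmpG W).
have nMi : Gs i :&: W \subset 'N(M) by rewrite (subset_trans _ nMG) // subIset ?sGG.
have tiM : M :&: (Gs i :&: W) = 1.
  apply/trivgP; rewrite -(bigjoin_eq1 i JM) /= setIC -setIA.
  by rewrite setIS // subsetIr.
rewrite /pgroup (card_isog (quotient_isog nMi tiM)).
by apply: pgroupS (quotientS M (subsetIr _ _)) tWM.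
Qed.

(** * Coprime action on normal p-subgroups *)

Lemma pgroup_p'group_trivg (gT : finGroupType) (pi : nat_pred) (A : {group gT}) :
  pi.-group A -> pi^'.-group A -> A :=: 1.
Proof. by move=> piA pi'A; apply: card1_trivg; apply: pnat_1 piA pi'A. Qed.

Lemma quotient_Sylow_p'group (gT : finGroupType) (q : nat) (G Q N : {group gT}) :
  G \subset 'N(N) -> q.-Sylow(G) Q -> Q \subset N -> q^'.-group (G / N).
Proof.
move=> nNG sylQ sQN.
have sylQN := quotient_pHall (subset_trans (pHall_sub sylQ) nNG) sylQ.
by rewrite -partG_eq1 -(card_Hall sylQN) /= (quotientS1 sQN) cards1.
Qed.

(** By coprime action the fixed points of [Q] in [Z / Z0] are the image of ['C_Z(Q)]. This image is
    everything, and ['C_Z(Q)] contains [Z0]. *)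
Lemma coprime_cent_factor (gT : finGroupType) (Z0 Z Q : {group gT}) :
    Z0 <| Z -> solvable Z -> coprime #|Z| #|Q| ->
    Q \subset 'C(Z0) -> Q / Z0 \subset 'C(Z / Z0) ->
  Q \subset 'C(Z).
Proof.
move=> /andP[sZ0Z nZ0Z] solZ coZQ cZ0Q cQZ0.
have nZ0Q : Q \subset 'N(Z0) by apply: subset_trans cZ0Q (cent_sub _).
have: Z / Z0 \subset 'C_Z(Q) / Z0.
  by rewrite (coprime_quotient_cent sZ0Z) // subsetI subxx centsC.
rewrite quotientSGK //; first by rewrite subsetI centsC => /andP[].
by rewrite subsetI sZ0Z centsC.
Qed.

(** The index of [Z0] in [Z] is 1 or [p]. In the second case [Z / Z0] has an automorphism group of
    order [p.-1], prime to [q], so [Q] acts trivially on it. *)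
Lemma prime_index_cent (gT : finGroupType) (p q : nat) (Z0 Z Q : {group gT}) :
    prime p -> prime q -> q != p -> q \notin \pi(p.-1) -> p.-group Z -> q.-group Q ->
    Z0 \subset Z -> #|Z| <= p * #|Z0| -> Q \subset 'N(Z) -> Q \subset 'C(Z0) ->
  Q \subset 'C(Z).
Proof.
move=> pr_p pr_q qp q'p1 pZ qQ sZ0Z leZ nZQ cZ0Q.
have [eqZ | ltZ] := eqVproper sZ0Z; first by rewrite -eqZ.
have leI : #|Z : Z0| <= p by rewrite -(leq_pmul2l (cardG_gt0 Z0)) Lagrange // mulnC.
have gtI : 1 < #|Z : Z0| by rewrite indexg_gt1 proper_subn.
have eqI : #|Z : Z0| = p.
  have /p_natP[[|k] eqk] : p.-nat #|Z : Z0| by apply: pnat_dvd (dvdn_indexg _ _) pZ.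
    by rewrite eqk in gtI.
  apply/eqP; rewrite eqn_leq leI eqk -{1}(expn1 p).
  by rewrite leq_exp2l ?prime_gt1.
have nsZ0 : Z0 <| Z.
  by apply: p_maximal_normal pZ _; apply: p_index_maximal; rewrite // eqI.
have nZ0Q : Q \subset 'N(Z0) by apply: subset_trans cZ0Q (cent_sub _).
have cardZZ0 : #|Z / Z0| = p by rewrite card_quotient ?normal_norm.
have nQZ0 : Q / Z0 \subset 'N(Z / Z0) by apply: quotient_norms.
have cQZ0 : Q / Z0 \subset 'C(Z / Z0).
  have qA : q.-group (conj_aut (Z / Z0) @* (Q / Z0)) by rewrite morphim_pgroup ?quotient_pgroup.
  have q'A : q^'.-group (conj_aut (Z / Z0) @* (Q / Z0)).
    apply: pgroupS (Aut_conj_aut _ _) _.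
    rewrite /pgroup card_Aut_cyclic ?prime_cyclic ?cardZZ0 // totient_prime //.
    rewrite p'natE //; apply: contra q'p1 => dvdq.
    by rewrite mem_primes pr_q dvdq -ltnS prednK ?prime_gt0 ?prime_gt1.
  by rewrite -ker_conj_aut ker_trivg_morphim nQZ0 (pgroup_p'group_trivg qA q'A) subxx.
have coZQ : coprime #|Z| #|Q|.
  by apply: pnat_coprime pZ (pi_pnat qQ _); rewrite !inE.
exact: coprime_cent_factor nsZ0 (pgroup_sol pZ) coZQ cZ0Q cQZ0.
Qed.

Section Centralise.

Variables (gT : finGroupType) (I : finType) (Gs : I -> {group gT}).
Variables (p q : nat) (G U : {group gT}).
Hypotheses (pr_p : prime p) (pr_q : prime q) (qp : q != p).
Hypothesis pmpG : pmp Gs.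
Hypothesis defG : G = (\prod_i Gs i)%G.
Hypothesis no_gamma : forall i j, i != j ->
  p \in \pi(Gs i) -> q \in \pi(Gs j) -> q \notin \pi(p.-1).
Hypotheses (nsUG : U <| G) (pU : p.-group U).
Hypothesis cent_own : forall i (Q : {group gT}),
  Q \subset Gs i -> q.-group Q -> Q \subset 'C(Gs i :&: U).

(* Every subgroup [X] of [G_i :&: U] yields a [Q]-invariant [X (G_j :&: U)], so
   [Q] acts on a chain from [G_j :&: U] whose steps have index 1 or [p]. *)
Lemma pmp_cent_setI i j (Q : {group gT}) :
  Q \subset Gs j -> q.-group Q -> Q \subset 'C(Gs i :&: U).
Proof.
move=> sQG qQ; have [<- | ij] := eqVneq j i; first exact: cent_own.
have [Q1 | ntQ] := eqVneq (Q : {set gT}) 1; first by rewrite Q1 sub1G.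
have qGj : q \in \pi(Gs j).
  have [_ dvdq _] := pgroup_pdiv qQ ntQ.
  by rewrite mem_primes pr_q cardG_gt0 (dvdn_trans dvdq) ?cardSg.
have sjG : Gs j \subset G by rewrite defG sub_bigjoin.
have nUj : Gs j \subset 'N(U) by rewrite (subset_trans sjG) ?normal_norm.
suff: forall X : {group gT}, X \subset Gs i :&: U -> Q \subset 'C(X <*> (Gs j :&: U)).
  move=> /(_ _ (subxx (Gs i :&: U))) /subset_trans -> //.
  by rewrite centS // joing_subl.
move=> X; have [m] := ubnP #|X|; elim: m X => // m IHm X; rewrite ltnS => leXm sX.
have [X1 | ntX] := eqVneq (X : {set gT}) 1.
  by rewrite X1 joing1G cent_own.
have pX : p.-group X by apply: pgroupS pU; apply: subset_trans sX (subsetIr _ _).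
have [_ dvdp _] := pgroup_pdiv pX ntX.
have pGi : p \in \pi(Gs i).
  rewrite mem_primes pr_p cardG_gt0 (dvdn_trans dvdp) ?cardSg //.
  exact: subset_trans sX (subsetIl _ _).
have [eqX1 | [Y maxY _]] := maximal_exists (sub1G X).
  by rewrite -eqX1 eqxx in ntX.
have ltYX := maxgroupp maxY; have sYX := proper_sub ltYX.
have sY := subset_trans sYX sX.
pose V := (Gs j :&: U)%G.
have comV (K : {group gT}) : K \subset Gs i :&: U -> K <*> V = K * V.
  by move=> sK; rewrite comm_joingE //; apply/commute_sym/(pmp_perm (pmp_setI pmpG U) _ sK).
have pZ : p.-group (X <*> V).
  by apply: pgroupS pU; rewrite join_subG subsetIr (subset_trans sX) ?subsetIr.
apply: (@prime_index_cent _ p q (Y <*> V)%G (X <*> V)%G) => //=.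
- by apply: (no_gamma (i := i) (j := j)); rewrite 1?eq_sym.
- by rewrite genS ?setSU.
(* The product formula gives [#|X * V| * #|X :&: V| = p * #|Y * V| * #|Y :&: V|], and [Y :&: V] lies
   in [X :&: V]. *)
- have lagX := Lagrange sYX; rewrite (p_maximal_index pX maxY) in lagX.
  rewrite !comV // -(leq_pmul2r (cardG_gt0 (X :&: V))) -mul_cardG -lagX.
  by rewrite mulnAC mul_cardG mulnC mulnA leq_mul // subset_leq_card ?setSI.
- by apply: subset_trans sQG (norm_mul_setI pmpG nUj _ sX).
by apply: IHm => //; apply: leq_trans leXm; apply: proper_card.
Qed.

(** The normal subgroup [C] contains a Sylow q-subgroup of every factor, so each factor has a
    q'-image modulo [C], and hence so has [G]. *)
Lemma pmp_cent (Q : {group gT}) :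
    U = (\prod_i (Gs i :&: U))%G -> Q \subset G -> q.-group Q ->
  Q \subset 'C(U).
Proof.
move=> defU sQG qQ; pose C := 'C_G(U)%G.
have nsCG : C <| G by rewrite /normal subsetIl normsI ?normG ?norms_cent ?normal_norm.
have sGG i : Gs i \subset G by rewrite defG sub_bigjoin.
have nCG := normal_norm nsCG.
have q'GC : q^'.-group (G / C).
  rewrite -[G / C]/(gval (G / C)%G) {1}defG -bigjoin_quotient; last first.
    by move=> i; apply: subset_trans (sGG i) nCG.
  apply: bigjoin_pgroup => [|i _].
    by apply/pmp_commute/pmp_quotient => // i; apply: subset_trans (sGG i) nCG.
  have [P sylP] := Sylow_exists q (Gs i).
  apply: (quotient_Sylow_p'group _ sylP); first exact: subset_trans (sGG i) nCG.
  have sPG := pHall_sub sylP.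
  rewrite subsetI (subset_trans sPG) //= centsC defU bigjoin_sub.
  apply/forall_inP=> k _; rewrite centsC.
  exact: pmp_cent_setI sPG (pHall_pgroup sylP).
have /eqP := pgroup_p'group_trivg (quotient_pgroup C qQ) (pgroupS (quotientS C sQG) q'GC).
rewrite -subG1 quotient_sub1; last exact: subset_trans sQG nCG.
by rewrite subsetI => /andP[].
Qed.

End Centralise.

(** * The induction shared by both graphs *)

(** [F] stands for the absence of the edge [(p, q)]; it ranges over all group types because the
    induction passes to quotients. Either a nontrivial ['O_p^'(G)] is factored out, or the subgroup
    [U] from [pmp_normal_primary] is a p-group, which [pmp_cent] shows to be centralised by all
    q-subgroups. *)
Lemma pmp_class_closed (p q : nat) (F : forall gT : finGroupType, {group gT} -> Prop) :
    prime p -> prime q -> q != p ->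
    (forall (gT : finGroupType) (G : {group gT}), G :=: 1 -> F gT G) ->
    (forall (gT : finGroupType) (G N : {group gT}),
       G \subset 'N(N) -> F gT G -> F _ (G / N)%G) ->
    (forall (gT : finGroupType) (G U Q : {group gT}),
       F gT G -> U <| G -> p.-group U -> Q \subset G -> q.-group Q ->
       Q \subset 'C(U)) ->
    (forall (gT : finGroupType) (G N : {group gT}),
       N <| G -> p^'.-group N -> F _ (G / N)%G -> F gT G) ->
    (forall (gT : finGroupType) (G U : {group gT}),
       'O_p^'(G) = 1 -> U <| G -> p.-group U ->
       (forall Q : {group gT}, Q \subset G -> q.-group Q -> Q \subset 'C(U)) ->
       F _ (G / U)%G -> F gT G) ->
  forall (gT : finGroupType) (I : finType) (Gs : I -> {group gT}),
    pmp Gs -> (forall i, solvable (Gs i)) ->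
    (forall i j, i != j -> p \in \pi(Gs i) -> q \in \pi(Gs j) -> q \notin \pi(p.-1)) ->
    (forall i, F gT (Gs i)) -> F gT (\prod_i Gs i)%G.
Proof.
move=> pr_p pr_q qp F1 Fquo Fcent Fp' Fp gT I Gs.
have [m] := ubnP #|(\prod_i Gs i)%G|.
elim: m => // m IHm in gT Gs *; rewrite ltnS => leGm pmpG solG no_gamma FG.
have solJ := pmp_solvable pmpG solG.
set G := (\prod_i Gs i)%G in leGm solJ *; have defG : G = (\prod_i Gs i)%G by [].
have sGG i : Gs i \subset G by apply: sub_bigjoin.
have [G1 | ntG] := eqVneq (G : {set gT}) 1; first exact: F1.
have FQ (N : {group gT}) : N <| G -> N :!=: 1 -> F _ (G / N)%G.
  move=> nsNG ntN; have nN i : Gs i \subset 'N(N).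
    by rewrite (subset_trans (sGG i)) ?normal_norm.
  rewrite -bigjoin_quotient //; apply: IHm.
  - by rewrite bigjoin_quotient // (leq_trans _ leGm) ?ltn_quotient ?normal_sub.
  - exact: pmp_quotient.
  - by move=> i; apply: quotient_sol.
  - have piQ r i : r \in \pi(Gs i / N) -> r \in \pi(Gs i).
      by apply: pi_of_dvd; rewrite ?cardG_gt0 ?dvdn_quotient.
    by move=> i j ij /piQ pi /piQ; apply: no_gamma ij pi.
  by move=> i; apply: Fquo.
have [O1 | ntO] := eqVneq 'O_p^'(G) 1; last first.
  apply: (Fp' _ _ 'O_p^'(G)%G); rewrite ?pcore_normal ?pcore_pgroup //.
  by apply: FQ; rewrite ?pcore_normal.
have [U [t [nsUG ntU pr_t tU defU]]] := pmp_normal_primary defG pmpG solJ ntG.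
have pU : p.-group U.
  have [<- // | tp] := eqVneq t p.
  have: U \subset 'O_p^'(G).
    apply: pcore_max nsUG; apply: sub_in_pnat tU => r _ /eqnP ->.
    by rewrite !inE.
  by rewrite O1 subG1 (negPf ntU).
apply: (Fp _ _ U) => //; last exact: FQ.
move=> Q sQG qQ; apply: (pmp_cent pr_p pr_q qp pmpG defG no_gamma nsUG pU) => //.
move=> i R sRG qR; apply: (Fcent _ (Gs i)) => //.
  by rewrite /normal subsetIl normsI ?normG ?(subset_trans (sGG i)) ?normal_norm.
exact: pgroupS (subsetIr _ _) pU.
Qed.

(** * Edge-free classes and their closure properties *)

Section Classes.

Variables p q : nat.
Hypotheses (pr_p : prime p) (pr_q : prime q) (qp : q != p).

(* For [p \in \pi(G)], the absence of the Hawkes edge [(p, q)]. *)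
Definition hawkes_free (gT : finGroupType) (G : {group gT}) :=
  forall Q : {group gT}, Q \subset G -> q.-group Q -> Q \subset 'O_p^'(G).

(* The absence of the [N]-critical edge [(p, q)]: a minimal non-nilpotent subgroup
   of a non-nilpotent [P Q] is a Schmidt [(p, q)]-group. *)
Definition ncritical_free (gT : finGroupType) (G : {group gT}) :=
  forall P Q : {group gT}, P \subset G -> Q \subset G -> p.-group P -> q.-group Q ->
  Q \subset 'N(P) -> Q \subset 'C(P).

Lemma q_group_p' (gT : finGroupType) (Q : {group gT}) : q.-group Q -> p^'.-group Q.
Proof. by move=> qQ; apply: pi_pgroup qQ _; rewrite !inE. Qed.

(** Up to conjugacy [Q] lies in the image of a Sylow q-subgroup of [G], and the image of ['O_p^'(G)]
    lies in ['O_p^'(G / N)]. *)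
Lemma hawkes_free_quotient (gT : finGroupType) (G N : {group gT}) :
  G \subset 'N(N) -> hawkes_free G -> hawkes_free (G / N)%G.
Proof.
move=> nNG freeG Q sQ qQ; have [P sylP] := Sylow_exists q G.
have sylPN : q.-Sylow(G / N) (P / N).
  by rewrite quotient_pHall // (subset_trans (pHall_sub sylP)).
have [x Gx sQxP] := Sylow_Jsub sylPN sQ qQ.
rewrite -(conjSg _ _ x) (subset_trans sQxP) //.
have /normalP[_ ->//] := pcore_normal p^' (G / N).
apply: subset_trans (morphim_pcore _ _ _).
by rewrite quotientS // freeG ?(pHall_pgroup sylP) ?(pHall_sub sylP).
Qed.

(** ['O_p^'(G)] and [U] are normal of coprime orders, so they commute. *)
Lemma hawkes_free_cent (gT : finGroupType) (G U Q : {group gT}) :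
    hawkes_free G -> U <| G -> p.-group U -> Q \subset G -> q.-group Q ->
  Q \subset 'C(U).
Proof.
move=> freeG nsUG pU sQG qQ; apply: subset_trans (freeG Q sQG qQ) _.
apply/commG1P/trivgP.
have <- : 'O_p^'(G) :&: U = 1.
  by rewrite setIC coprime_TIg // (pnat_coprime pU (pcore_pgroup _ _)).
rewrite commg_subI // subsetI ?subxx.
  by rewrite (subset_trans (pcore_sub _ _)) ?normal_norm.
by rewrite (subset_trans (normal_sub nsUG)) ?gFnorm.
Qed.

Lemma hawkes_free_p'quotient (gT : finGroupType) (G N : {group gT}) :
  N <| G -> p^'.-group N -> hawkes_free (G / N)%G -> hawkes_free G.
Proof.
move=> nsNG p'N freeGN Q sQG qQ.
have := freeGN (Q / N)%G (quotientS N sQG) (quotient_pgroup N qQ).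
rewrite /= pquotient_pcore // quotientSGK //; last exact: pcore_max.
exact: subset_trans sQG (normal_norm nsNG).
Qed.

(** With [V / U] the p'-core of [G / U], [Q] lies in [D], the centraliser of [U] in [V]. There [Z]
    is a central Hall p-subgroup, so its Schur-Zassenhaus complement [K] is a normal p'-subgroup of
    [D], inside ['O_p^'(G) = 1]. Thus [D] is a p-group and [Q] is trivial. *)
Lemma hawkes_free_cent_quotient (gT : finGroupType) (G U : {group gT}) :
    'O_p^'(G) = 1 -> U <| G -> p.-group U ->
    (forall Q : {group gT}, Q \subset G -> q.-group Q -> Q \subset 'C(U)) ->
  hawkes_free (G / U)%G -> hawkes_free G.
Proof.
move=> O1 nsUG pU centU freeGU Q sQG qQ; have nUG := normal_norm nsUG.
have [V defV sUV nsVG] := inv_quotientN nsUG (pcore_normal p^' (G / U)).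
have sQV : Q \subset V.
  rewrite -(quotientSGK _ sUV) ?(subset_trans sQG) // -defV.
  by apply: freeGU; rewrite ?quotientS ?quotient_pgroup.
pose D := (V :&: 'C_G(U))%G; pose Z := (U :&: D)%G.
have nsDG : D <| G.
  apply: normalI nsVG _.
  by rewrite /normal subsetIl normsI ?normG ?norms_cent ?normal_norm.
have sQD : Q \subset D by rewrite !subsetI sQV sQG centU.
have nsZD : Z <| D by rewrite /normal subsetIr normsI ?normG ?(subset_trans (normal_sub nsDG)).
have cZD : D \subset 'C(Z).
  by apply: subset_trans (centS (subsetIl U D)); rewrite /= setIA subsetIr.
have p'DZ : p^'.-group (D / Z).
  have nUD := subset_trans (normal_sub nsDG) nUG.
  rewrite /pgroup (card_isog (second_isog nUD)).
  apply: pgroupS (pcore_pgroup p^' (G / U)); rewrite defV quotientS //.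
  exact: subsetIl.
have hallZ : p.-Hall(D) Z.
  rewrite /pHall subsetIr (pgroupS (subsetIl _ _) pU) /=.
  by rewrite -card_quotient ?normal_norm.
have /splitsP[K /complP[tiZK defD]] := SchurZassenhaus_split (pHall_Hall hallZ) nsZD.
have sKD : K \subset D by rewrite -defD mulG_subr.
have nsKD : K <| D.
  rewrite /normal sKD -defD mul_subG ?normG //.
  by rewrite cents_norm // centsC (subset_trans sKD).
have p'K : p^'.-group K.
  have := p'DZ; rewrite -{1}defD /= quotientMidl /pgroup.
  by rewrite -(card_isog (quotient_isog _ tiZK)) // (subset_trans sKD) ?normal_norm.
have K1 : K :=: 1.
  apply/trivgP; rewrite -O1; apply: subset_trans (pcore_max p'K nsKD) _.
  by rewrite pcore_max ?pcore_pgroup // (char_normal_trans (pcore_char _ _)).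
have pD : p.-group D by rewrite -defD K1 mulg1; apply: pgroupS (subsetIl _ _) pU.
by rewrite (pgroup_p'group_trivg (pgroupS sQD pD) (q_group_p' qQ)) sub1G.
Qed.

(** The pair is lifted to [G]: a Sylow p-subgroup [P] of the preimage [V] maps onto [Pb], and by the
    Frattini argument ['N_T(P)] covers [T / N]. A Sylow q-subgroup of ['N_T(P)] centralises [P], and
    its image contains a conjugate of [Qb]. *)
Lemma ncritical_free_quotient (gT : finGroupType) (G N : {group gT}) :
  G \subset 'N(N) -> ncritical_free G -> ncritical_free (G / N)%G.
Proof.
move=> nNG freeG Pb Qb sPb sQb pPb qQb nPQ.
have lift (A : {group coset_of N}) : A \subset G / N ->
    (G :&: coset N @*^-1 A) / N = A.
  by move=> sA; rewrite /quotient morphim_setIpre; apply/setIidPr.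
pose V := (G :&: coset N @*^-1 Pb)%G; pose T := (G :&: coset N @*^-1 (Qb <*> Pb))%G.
have sTG : T \subset G := subsetIl _ _.
have nNT := subset_trans sTG nNG.
have defT : T / N = Qb <*> Pb by apply: lift; rewrite join_subG sQb.
have nsPT : Pb <| Qb <*> Pb by rewrite /normal joing_subr join_subG nPQ normG.
have nsVT : V <| T.
  rewrite /normal setIS ?morphpreS ?joing_subr //= normsI //.
    by rewrite (subset_trans sTG) ?normG.
  by rewrite subIset // morphpre_norms ?orbT ?normal_norm.
have [P sylP] := Sylow_exists p V.
have nNP := subset_trans (pHall_sub sylP) (subset_trans (normal_sub nsVT) nNT).
have defV : V / N = Pb by apply: lift.
have defPN : P / N = Pb.
  by have := quotient_pHall nNP sylP; rewrite /= defV => /pHall_id; apply.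
have defL : 'N_T(P) / N = T / N.
  have nNV := subset_trans (normal_sub nsVT) nNT.
  have <- : V / N * ('N_T(P) / N) = T / N by rewrite -quotientMl // (Frattini_arg nsVT sylP).
  rewrite defV -defPN mulSGid // quotientS // subsetI normG andbT.
  exact: subset_trans (pHall_sub sylP) (normal_sub nsVT).
have [Q sylQ] := Sylow_exists q 'N_T(P)%G.
have [sQT nPQ'] := subsetIP (pHall_sub sylQ).
have sylQN := quotient_pHall (subset_trans sQT nNT) sylQ.
have sQbL : Qb \subset 'N_T(P) / N by rewrite defL defT joing_subl.
have [x Lx sQx] := Sylow_Jsub sylQN sQbL qQb.
have cPQ : Q \subset 'C(P).
  apply: freeG nPQ'; rewrite ?(pHall_pgroup sylP) ?(pHall_pgroup sylQ) //.
    exact: subset_trans (pHall_sub sylP) (subset_trans (normal_sub nsVT) sTG).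
  exact: subset_trans sQT sTG.
(* The conjugating element lies in [T / N], which normalises [Pb]. *)
have nPx : Pb :^ x = Pb.
  apply: (normsP (normal_norm nsPT)).
  by move: Lx; rewrite /= defL defT.
rewrite -(conjSg _ _ x) -centJ nPx (subset_trans sQx) //= -defPN.
exact: quotient_cents.
Qed.

Lemma ncritical_free_p'quotient (gT : finGroupType) (G N : {group gT}) :
  N <| G -> p^'.-group N -> ncritical_free (G / N)%G -> ncritical_free G.
Proof.
move=> nsNG p'N freeGN P Q sPG sQG pP qQ nPQ; have nNG := normal_norm nsNG.
have: Q / N \subset 'C(P / N).
  by apply: freeGN; rewrite ?quotientS ?quotient_pgroup ?quotient_norms.
rewrite quotient_cents2 ?(subset_trans _ nNG) // => sQPN.
apply/commG1P/trivgP.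
have <- : N :&: P = 1 by rewrite setIC coprime_TIg // (pnat_coprime pP).
by rewrite subsetI sQPN commg_subr.
Qed.

(** [Q] centralises [U :&: P] and, modulo it, [P]; coprime action gives the rest. *)
Lemma ncritical_free_cent_quotient (gT : finGroupType) (G U : {group gT}) :
    U <| G ->
    (forall Q : {group gT}, Q \subset G -> q.-group Q -> Q \subset 'C(U)) ->
  ncritical_free (G / U)%G -> ncritical_free G.
Proof.
move=> nsUG centU freeGU P Q sPG sQG pP qQ nPQ; have nUG := normal_norm nsUG.
have: Q / U \subset 'C(P / U).
  by apply: freeGU; rewrite ?quotientS ?quotient_pgroup ?quotient_norms.
rewrite quotient_cents2 ?(subset_trans _ nUG) // => sQPU.
have cUPQ : Q \subset 'C(U :&: P).
  by apply: subset_trans (centU Q sQG qQ) (centS (subsetIl _ _)).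
have nsUP : U :&: P <| P.
  by rewrite /normal subsetIr normsI ?normG ?(subset_trans sPG).
apply: (coprime_cent_factor nsUP (pgroup_sol pP) _ cUPQ).
  exact: pnat_coprime pP (q_group_p' qQ).
have nUPQ := subset_trans cUPQ (cent_sub _).
by rewrite quotient_cents2 ?(normal_norm nsUP) // subsetI sQPU commg_subr.
Qed.

Lemma ncritical_free_schmidt (gT : finGroupType) (G S : {group gT}) :
  ncritical_free G -> S \subset G -> ~ schmidt_pq p q S.
Proof.
move=> freeG sSG [[nnilS _] [piS [P [sylP nsPS]]]].
have [Q sylQ] := Sylow_exists q S.
have [sPS pP _] := and3P sylP; have [sQS qQ _] := and3P sylQ.
have cPQ : Q \subset 'C(P).
  apply: freeG; rewrite ?(subset_trans _ sSG) //.
  exact: subset_trans sQS (normal_norm nsPS).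
case/negP: nnilS; have <- : P * Q = S.
  (* As only [p] and [q] divide [#|S|], its p'-part is its q-part. *)
  apply/eqP; rewrite eqEcard mul_subG //= coprime_cardMg; last first.
    exact: pnat_coprime pP (q_group_p' qQ).
  rewrite (card_Hall sylP) (card_Hall sylQ) -[leqLHS](@partnC p #|S|) ?cardG_gt0 //.
  rewrite leq_mul2l (@eq_in_partn p^' q) ?leqnn ?orbT // => r.
  rewrite piS !inE => /orP[] /eqP->; last by rewrite qp eqxx.
  by rewrite eqxx eq_sym (negPf qp).
by rewrite mulg_nil // (pgroup_nil pP) (pgroup_nil qQ).
Qed.

(** Subgroups of coprime orders in a nilpotent group commute, so a pair violating the condition
    generates a non-nilpotent group, which has a minimal non-nilpotent subgroup [S]. *)
Lemma not_ncritical_free_schmidt (gT : finGroupType) (G : {group gT}) :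
    ~ (exists S : {group gT}, S \subset G /\ schmidt_pq p q S) ->
  ncritical_free G.
Proof.
move=> noS P Q sPG sQG pP qQ nPQ; apply/negPn/negP=> ncPQ; case: noS.
pose T := (P <*> Q)%G.
have nnilT : ~~ nilpotent T.
  apply: contra ncPQ => nilT; apply: (sub_nilpotent_cent2 nilT).
  - exact: joing_subl.
  - exact: joing_subr.
  exact: pnat_coprime pP (q_group_p' qQ).
have [|S] := @mingroup_exists _ (fun S => ~~ nilpotent S) T; first exact: nnilT.
move=> /mingroupP[nnilS minS] sST; exists S.
split; first by rewrite (subset_trans sST) // join_subG sPG.
have defT : P * Q = T by rewrite /= norm_joinEr.
have [sylP _] := coprime_mulpG_Hall defT pP (q_group_p' qQ).
have nsPT : P <| T by rewrite /normal joing_subl join_subG normG.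
have schS : schmidt S.
  split=> // H ltHS; apply/negPn/negP=> nnilH.
  by have eqH := minS H nnilH (proper_sub ltHS); rewrite eqH properxx in ltHS.
have sylPS := setI_normal_Hall nsPT sylP sST.
have piST r : r \in \pi(S) -> r \in [:: p; q].
  move/(piSg sST); rewrite mem_primes => /and3P[pr_r _].
  rewrite /= -defT coprime_cardMg ?(pnat_coprime pP (q_group_p' qQ)) // Euclid_dvdM //.
  by case/orP=> [/(pgroupP pP r pr_r)|/(pgroupP qQ r pr_r)]; rewrite !inE => ->; rewrite ?orbT.
(* If [a] did not divide [#|S|], [S] would be a [b]-group and hence nilpotent; this serves both
   orders of [p] and [q]. *)
have piS a b : {subset [:: p; q] <= [:: a; b]} -> a \in \pi(S).
  move=> sub; apply: contraR nnilS => aS; apply: (@pgroup_nil _ b).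
  apply: sub_in_pnat (pgroup_pi S) => r rS _.
  have := sub r (piST r rS); rewrite !inE => /orP[/eqP eqr|//].
  by rewrite -eqr rS in aS.
split=> //; split=> [r | ].
  apply/idP/idP=> [/piST // |]; rewrite !inE => /orP[] /eqP->.
    exact: (piS p q).
  by apply: (piS q p) => r'; rewrite !inE orbC.
by exists (P :&: S)%G; rewrite /normal subsetIr normsI ?normG ?(subset_trans sST) ?normal_norm.
Qed.

(** If [p] does not divide [#|G|], then ['O_p^'(G)] is [G]. Otherwise q-subgroups lie in
    ['O_{p^',p}(G)], which is a p-group modulo ['O_p^'(G)], so they already lie in the latter. *)
Lemma hawkes_edge_free (gT : finGroupType) (G : {group gT}) :
  ~ edge (hawkes_graph G) p q -> hawkes_free G.
Proof.
move=> noE Q sQG qQ.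
have [pG | ] := boolP (p \in \pi(G)); last first.
  by rewrite -p'groupEpi => p'G; rewrite pcore_pgroup_id.
have q'G : q^'.-group (G / 'O_{p^',p}(G)).
  by rewrite p'groupEpi; apply/negP=> qG; apply: noE.
have nO1 : G \subset 'N('O_p^'(G)) by apply: gFnorm.
have nO2 : G \subset 'N('O_{p^',p}(G)) by apply: gFnorm.
have sQO : Q \subset 'O_{p^',p}(G).
  rewrite -quotient_sub1 ?(subset_trans sQG) // subG1; apply/eqP.
  exact: pgroup_p'group_trivg (quotient_pgroup _ qQ) (pgroupS (quotientS _ sQG) q'G).
rewrite -quotient_sub1 ?(subset_trans sQG) // subG1; apply/eqP.
apply: pgroup_p'group_trivg (quotient_pgroup _ qQ) _.
have: Q / 'O_p^'(G) \subset 'O_p(G / 'O_p^'(G)).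
  by rewrite -quotient_pseries2 quotientS.
move/pgroupS/(_ (pcore_pgroup _ _)) => pQ; apply: pi_pgroup pQ _.
by rewrite !inE eq_sym.
Qed.

Lemma hawkes_free_edge (gT : finGroupType) (G : {group gT}) :
  hawkes_free G -> ~ edge (hawkes_graph G) p q.
Proof.
move=> freeG [_ qG]; have [Q sylQ] := Sylow_exists q G.
have sO : 'O_p^'(G) \subset 'O_{p^',p}(G).
  by rewrite -pseries1; apply: (pseries_sub_catl [:: _] [:: _]).
have nO : G \subset 'N('O_{p^',p}(G)) by apply: gFnorm.
have sQO := subset_trans (freeG Q (pHall_sub sylQ) (pHall_pgroup sylQ)) sO.
have := quotient_Sylow_p'group nO sylQ sQO.
by rewrite p'groupEpi => /negP; apply.
Qed.

End Classes.

(** * The two inclusions *)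

Lemma schmidt_pq_neq (gT : finGroupType) (p q : nat) (S : {group gT}) :
  schmidt_pq p q S -> q != p.
Proof.
case=> [[nnilS _] [piS _]]; apply: contraNneq nnilS => eqqp.
apply: (@pgroup_nil _ p); apply: sub_in_pnat (pgroup_pi S) => r.
by rewrite piS eqqp !inE orbb => ->.
Qed.

Theorem theorem4 (gT : finGroupType) (G : {group gT}) (n : nat)
    (Gs : 'I_n -> {group gT})
    (solGs : forall i, solvable (Gs i))
    (prodG : (G : {set gT}) = \prod_(i < n) (Gs i : {set gT}))
    (mpGs : forall i j, i != j -> mutually_permutable (Gs i) (Gs j)) :
  subgraph (hawkes_graph G)
    (gunion (gbigunion (fun _ : 'I_n => True) (fun i => hawkes_graph (Gs i)))
      (gunion (gbigunion (fun ij : 'I_n * 'I_n => ij.1 != ij.2)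
                         (fun ij => gamma_graph (Gs ij.1) (Gs ij.2)))
              (loop_graph G)))
  /\
  subgraph (ncritical_graph G)
    (gunion (gbigunion (fun _ : 'I_n => True) (fun i => ncritical_graph (Gs i)))
            (gbigunion (fun ij : 'I_n * 'I_n => ij.1 != ij.2)
                       (fun ij => gamma_graph (Gs ij.1) (Gs ij.2)))).
Proof.
have comG := pmp_commute mpGs.
have defG : G = (\prod_i Gs i)%G by apply: val_inj; rewrite /= prodG prodsg_bigjoin.
have piG p : p \in \pi(G) -> exists2 i : 'I_n, True & p \in \pi(Gs i).
  move=> pG; apply: NNPP => noi.
  suff: p^'.-group G by rewrite p'groupEpi pG.
  rewrite defG; apply: bigjoin_pgroup => // i _.
  by rewrite p'groupEpi; apply/negP=> pGi; apply: noi; exists i.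
have piP (H : {group gT}) p : p \in \pi(H) -> prime p by rewrite mem_primes => /and3P[].
split; split.
- by move=> p /piG; left.
(* Loops are absorbed by the loop graph; for [q != p] a missing edge on the right makes every
   factor, and hence [G], free of the edge. *)
- move=> p q [pG qG]; have [eq_qp | qp] := eqVneq q p; first by right; right.
  have pr_p := piP G p pG.
  have pr_q : prime q by move: qG; rewrite mem_primes => /and3P[].
  apply: NNPP => noE; apply: (@hawkes_free_edge p q gT G) => //.
  rewrite defG; apply: (@pmp_class_closed p q (@hawkes_free p q)) => //.
  + by move=> hT H H1 Q; rewrite H1 => /trivgP->; rewrite sub1G.
  + exact: hawkes_free_quotient.
  + exact: hawkes_free_cent.
  + exact: hawkes_free_p'quotient.
  + by move=> hT H U; apply: hawkes_free_cent_quotient.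
  + move=> i j ij pi qj; apply/negP=> qp1; apply: noE.
    by right; left; exists (i, j) => //; left.
  move=> i; apply: hawkes_edge_free => // -[pi qi]; apply: noE.
  by left; exists i.
- by move=> p /piG; left.
move=> p q [S [sSG schS]]; have qp := schmidt_pq_neq schS.
have [pr_p pr_q] : prime p /\ prime q.
  have [_ [piS _]] := schS.
  by split; apply: (piP S); rewrite piS !inE eqxx ?orbT.
apply: NNPP => noE; suff freeG : ncritical_free p q G.
  exact: ncritical_free_schmidt freeG sSG schS.
rewrite defG; apply: (@pmp_class_closed p q (@ncritical_free p q)) => //.
+ move=> hT H H1 P Q _; rewrite H1 => /trivgP-> *; exact: sub1G.
+ exact: ncritical_free_quotient.
+ move=> hT H U Q freeH nsUH pU sQH qQ; apply: (freeH U Q (normal_sub nsUH)) => //.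
  exact: subset_trans sQH (normal_norm nsUH).
+ exact: ncritical_free_p'quotient.
+ by move=> hT H U _ nsUH _; apply: ncritical_free_cent_quotient.
+ move=> i j ij pi qj; apply/negP=> qp1; apply: noE.
  by right; exists (i, j) => //; left.
move=> i; apply: not_ncritical_free_schmidt => // -[R [sR schR]]; apply: noE.
by left; exists i => //; exists R.
Qed.
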